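(* Consider two vector subspaces $V_1,V_2\subset H$ of a Hilbert space $H=H_1\oplus H_2$. Suppose that $V_1$ is comparable with the graph of a closed mapping $A_1\colon H_1\to H_2$ and the relative dimension of $V_1$ and this graph is $d_1$. Suppose that $V_2$ is comparable with the graph of a bounded mapping $A_2\colon H_2\to H_1$ and the relative dimension of $V_2$ and this graph is $d_2$. If $A_1\circ A_2$ is defined everywhere, and either $A_1\circ A_2$ is compact, or $A_2\circ A_1|_{\operatorname{Dom}A_1}$ is compact, then $V_1$ and $V_2$ are quasi-complementary in the space $\operatorname{Dom}(A_1)\oplus H_2$ with the excess $d_1+d_2$.
   Context: A closed mapping $A_1\colon H_1\to H_2$ is a linear operator defined on a dense subspace $\operatorname{Dom}(A_1)\subset H_1$ (possibly unbounded) whose graph is closed in $H_1\oplus H_2$. The graphs $\{(h,A_1h):h\in\operatorname{Dom}A_1\}$ and $\{(A_2h',h'):h'\in H_2\}$ are viewed as subspaces of $H_1\oplus H_2$. If $A_1$ is not bounded, $\operatorname{Dom}(A_1)$ is considered as a Hilbert space with the norm $\|v\|_{A_1}^2=\|v\|^2+\|A_1v\|^2$. The composition $A_1\circ A_2$ is defined on those $h'\in H_2$ with $A_2h'\in\operatorname{Dom}(A_1)$. Two subspaces $S_1,S_2$ of a topological vector space are comparable if $S_1\cap S_2$ has finite codimension in both $S_1$ and $S_2$; the relative dimension $\operatorname{reldim}(S_1,S_2)$ is then the difference of these codimensions (the codimension in $S_1$ minus the codimension in $S_2$). Two subspaces $S_1,S_2$ of a topological vector space $S$ are quasi-complementary if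 $\dim(S_1\cap S_2)<\infty$ and $\operatorname{codim}(S_1+S_2)<\infty$ (codimension in $S$); the excess of such a pair is $\dim(S_1\cap S_2)-\operatorname{codim}(S_1+S_2)$.
   Formalization: V1 and V2 are assumed to lie in Dom(A1)⊕H2 (automatic if A1 is bounded), since otherwise quasi-complementarity in that space is undefined and the claim fails; compactness of A2∘A1 on Dom(A1) is meant as an operator from Dom(A1) to itself in the graph norm. *)

(* Defs.v *)
From HB Require Import structures.
From mathcomp Require Import all_boot all_order all_algebra.
From mathcomp Require Import complex.
From mathcomp Require Import boolp classical_sets functions reals topology.
From mathcomp Require Import normedtype sequences.

Set Implicit Arguments.
Unset Strict Implicit.
Unset Printing Implicit Defensive.

Import Order.TTheory GRing.Theory Num.Theory.
Import numFieldNormedType.Exports.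

Local Open Scope classical_set_scope.
Local Open Scope ring_scope.

(** Hilbert spaces, real or complex *)

Variant scalars := RealScalars | ComplexScalars.

Definition scalar_field (R : realType) (s : scalars) : numFieldType :=
  match s with
  | RealScalars => R
  | ComplexScalars => R[i]
  end.

Definition scalar_conj (R : realType) (s : scalars) :
    scalar_field R s -> scalar_field R s :=
  match s with
  | RealScalars => idfun
  | ComplexScalars => fun z : R[i] => z^*
  end.

(* Norms take values in the scalar field; `x <= y` in R[i] says that y - x is
   a nonnegative real. *)
Record hilbertType (R : realType) (s : scalars) := HilbertType {
  hilbert_sort :> completeNormedModType (scalar_field R s);
  hilbert_dot : {dot hilbert_sort for @scalar_conj R s};
  hilbert_normE : forall x : hilbert_sort, `|x| ^+ 2 = hilbert_dot x x }.

(** Subspaces, given as sets of vectors *)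

Section Subspaces.
Context {K : fieldType} {E : lmodType K}.
Implicit Types S W : set E.

Definition is_subspace S := submod_closed [in S].

(* dim (S / W) = n: the classes of b 0, ..., b (n - 1) form a basis of S / W *)
Definition has_codim W S (n : nat) :=
  exists b : 'I_n -> E, (forall i, S (b i)) /\
    forall x, S x -> exists! c : 'rV[K]_n, W (x - \sum_i c 0 i *: b i).

Definition has_dim S n := has_codim [set 0] S n.

Definition sum_subspaces S1 S2 : set E := [set x + y | x in S1 & y in S2].

(* S1 and S2 are comparable, and reldim (S1, S2) = d *)
Definition comparable_reldim S1 S2 (d : int) :=
  exists n1 n2 : nat, [/\ has_codim (S1 `&` S2) S1 n1,
    has_codim (S1 `&` S2) S2 n2 & d = n1%:Z - n2%:Z].

(* S1 and S2 are subspaces of S, quasi-complementary in S, with excess d *)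
Definition quasi_complementary_excess S S1 S2 (d : int) :=
  [/\ S1 `<=` S, S2 `<=` S & exists n m : nat, [/\ has_dim (S1 `&` S2) n,
    has_codim (sum_subspaces S1 S2) S m & d = n%:Z - m%:Z]].

End Subspaces.

(** Closed mappings *)

(* The values of [cfun] outside of [cdom] are irrelevant. The topology of
   H1 * H2 is the product topology, which is that of the Hilbert direct sum. *)
Record closed_mapping (K : numFieldType) (H1 H2 : normedModType K) :=
  ClosedMapping {
    cdom : set H1;
    cfun :> H1 -> H2;
    cdom_subspace : is_subspace cdom;
    cdom_dense : dense cdom;
    cfun_linear : forall (a : K) (u v : H1), cdom u -> cdom v ->
      cfun (a *: u + v) = a *: cfun u + cfun v;
    cfun_closed : closed [set p : H1 * H2 | cdom p.1 /\ p.2 = cfun p.1] }.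

Section Mappings.
Context {K : numFieldType} {H1 H2 : normedModType K}.

Definition graph1 (A : closed_mapping H1 H2) : set (H1 * H2) :=
  [set p | cdom A p.1 /\ p.2 = A p.1].

Definition graph2 (A : H2 -> H1) : set (H1 * H2) := [set p | p.1 = A p.2].

Definition graph_norm_sqr (A : closed_mapping H1 H2) (v : H1) : K :=
  `|v| ^+ 2 + `|A v| ^+ 2.

End Mappings.

(* T is a compact operator on the subspace D of E with norm N: every bounded
   sequence in D has a subsequence whose image under T converges in D. Only
   boundedness and convergence to 0 of values of N are involved, so N may as
   well be the square of a norm. *)
Definition compact_on (K : numFieldType) (E : lmodType K) (D : set E)
    (N : E -> K) (T : E -> E) :=
  forall u : nat -> E, (forall n, D (u n)) ->
    (exists M : K, forall n, N (u n) <= M) ->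
  exists phi : nat -> nat, increasing_seq phi /\
    exists2 w, D w & (fun n => N (T (u (phi n)) - w)) @ \oo --> (0 : K).

(* Main.v *)
Require Import Defs.
From HB Require Import structures.
From mathcomp Require Import all_boot all_order all_algebra.
From mathcomp Require Import complex ring lra.
From mathcomp Require Import boolp classical_sets functions reals.
From mathcomp Require Import interval_inference topology.
From mathcomp Require Import normedtype sequences.

Set Implicit Arguments.
Unset Strict Implicit.
Unset Printing Implicit Defensive.

Import Order.TTheory GRing.Theory Num.Theory.
Import numFieldNormedType.Exports.

Local Open Scope classical_set_scope.
Local Open Scope ring_scope.

(** The graphs themselves are treated first. A point of
    graph A1 `&` graph A2 is (A2 h', h') with h' = A1 (A2 h'), and modulo
    graph A1 + graph A2 every vector of Dom A1 `*` H2 can be moved into H2,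
    where it is known up to the range of 1 - A1 \o A2. The excess of the pair of
    graphs is therefore the index of 1 - A1 \o A2 on H2
    ([graph_excess_cod]). Moving vectors into Dom A1 instead of H2 shows that it
    is equally the index of 1 - A2 \o A1 on Dom A1 ([graph_excess_dom]). By
    hypothesis one of the two composites is compact, on H2 or on Dom A1 with
    its graph norm, so that the index is 0 by the theorem of Riesz
    ([riesz_index0]).

    Passing from a subspace U to V, with U in V of codimension k, raises the
    excess with any third subspace W by exactly k: the k new dimensions are
    shared out between V `&` W and V + W ([has_codim_cap_sum], [excess_codim]).
    Going from graph A1 down to its intersection with V1 and then up to V1
    changes the excess by the relative dimension d1, and likewise for V2 and d2
    ([excess_comparable]).

    The Riesz theory is developed on an arbitrary vector space over the scalars
    with a real-valued norm, because Dom A1 has to be taken with the graph norm.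
    Write S = 1 - T with T compact. Every power of S is again the identity minus
    a compact operator ([iter_compact_perturbation]), so that its kernel has
    finite dimension ([ker_has_dim]) and its range is closed ([vclosed_range]).
    A strictly monotone chain of closed subspaces between which S moves down
    would give, by the lemma of Riesz, unit vectors whose images under T stay
    at distance 1/2 from each other, against compactness ([riesz_chain]); so the
    kernels and the ranges of the powers of S become constant, at some exponent
    t. Then the kernel of S^t is finite-dimensional, stable under S and a
    complement of the range of S^t, which is contained in the range of S: the
    index of S is that of its restriction to a finite-dimensional space. *)

(** * Subspaces and linear combinations *)

Section SubspaceClosure.
Context {K : fieldType} {E : lmodType K}.
Implicit Types S W U : set E.

Lemma is_subspaceP S : is_subspace S <->
  S 0 /\ forall (a : K) (u v : E), S u -> S v -> S (a *: u + v).
Proof.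
split=> [[S0 Sl]|[S0 Sl]].
  split; first by rewrite inE in S0.
  move=> a u v Su Sv; have := Sl a u v; rewrite !inE; exact.
by split=> [|a u v]; rewrite !inE //; apply: Sl.
Qed.

Lemma subspace0 S : is_subspace S -> S 0.
Proof. by case/is_subspaceP. Qed.

Lemma subspaceZD S a u v : is_subspace S -> S u -> S v -> S (a *: u + v).
Proof. by case/is_subspaceP=> _; apply. Qed.

Lemma subspaceZ S a u : is_subspace S -> S u -> S (a *: u).
Proof.
by move=> sS Su; rewrite -[_ *: _]addr0; apply: subspaceZD (subspace0 sS).
Qed.

Lemma subspaceD S u v : is_subspace S -> S u -> S v -> S (u + v).
Proof. by move=> sS Su Sv; rewrite -[u]scale1r; apply: subspaceZD. Qed.

Lemma subspaceB S u v : is_subspace S -> S u -> S v -> S (u - v).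
Proof. by move=> sS Su Sv; rewrite addrC -scaleN1r; apply: subspaceZD. Qed.

Lemma subspaceN S u : is_subspace S -> S u -> S (- u).
Proof.
by move=> sS Su; rewrite -sub0r; apply: subspaceB (subspace0 sS) Su.
Qed.

Lemma subspace_setT : is_subspace [set: E].
Proof. exact/is_subspaceP. Qed.

Lemma subspace_set0 : is_subspace [set 0 : E].
Proof. by apply/is_subspaceP; split=> // a u v /= -> ->; rewrite scaler0 addr0. Qed.

Lemma subspaceI S W : is_subspace S -> is_subspace W -> is_subspace (S `&` W).
Proof.
move=> sS sW; apply/is_subspaceP; split; first by split; apply: subspace0.
by move=> a u v [? ?] [? ?]; split; apply: subspaceZD.
Qed.

Lemma subspace_sum S W :
  is_subspace S -> is_subspace W -> is_subspace (sum_subspaces S W).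
Proof.
move=> sS sW; apply/is_subspaceP; split.
  by exists 0; [exact: subspace0|exists 0; [exact: subspace0|rewrite addr0]].
move=> a _ _ [u Su [v Wv <-]] [u' Su' [v' Wv' <-]].
exists (a *: u + u'); first exact: subspaceZD.
exists (a *: v + v'); first exact: subspaceZD.
by rewrite scalerDr addrACA.
Qed.

Lemma sub_suml S W : is_subspace W -> S `<=` sum_subspaces S W.
Proof.
move=> sW x Sx; exists x => //.
by exists 0; [exact: subspace0|rewrite addr0].
Qed.

Lemma sub_sumr S W : is_subspace S -> W `<=` sum_subspaces S W.
Proof.
move=> sS x Wx; exists 0; first exact: subspace0.
by exists x; rewrite // add0r.
Qed.

Lemma sum_sub S W U : is_subspace U -> S `<=` U -> W `<=` U ->
  sum_subspaces S W `<=` U.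
Proof.
move=> sU SU WU _ [x Sx [y Wy <-]].
by apply: subspaceD; [|exact: SU|exact: WU].
Qed.

End SubspaceClosure.

Section LinearSubspaces.
Context {K : fieldType} {E E' : lmodType K} (f : {linear E -> E'}).

Lemma subspace_preimage (S : set E') : is_subspace S -> is_subspace (f @^-1` S).
Proof.
move=> sS; apply/is_subspaceP; split; first by rewrite /= linear0; apply: subspace0.
by move=> a u v /= Su Sv; rewrite linearP; apply: subspaceZD.
Qed.

Lemma subspace_image (S : set E) : is_subspace S -> is_subspace (f @` S).
Proof.
move=> sS; apply/is_subspaceP; split.
  by exists 0; [exact: subspace0|exact: linear0].
move=> a _ _ [u Su <-] [v Sv <-]; exists (a *: u + v); first exact: subspaceZD.
by rewrite linearP.
Qed.

Lemma subspace_ker : is_subspace [set x | f x = 0].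
Proof. exact: (subspace_preimage (@subspace_set0 _ _)). Qed.

End LinearSubspaces.

Section LinearCombinations.
Context {K : fieldType} {E : lmodType K}.

Definition lincomb n (b : 'I_n -> E) (c : 'rV[K]_n) : E :=
  \sum_i c 0 i *: b i.

Fact lincomb_is_linear n (b : 'I_n -> E) : linear (lincomb b).
Proof.
move=> a u v; rewrite /lincomb scaler_sumr -big_split.
by apply: eq_bigr => i _ /=; rewrite !mxE scalerDl scalerA.
Qed.

HB.instance Definition _ n (b : 'I_n -> E) :=
  GRing.isLinear.Build K 'rV[K]_n E _ (lincomb b) (lincomb_is_linear b).

Lemma subspace_lincomb (S : set E) n (b : 'I_n -> E) c :
  is_subspace S -> (forall i, S (b i)) -> S (lincomb b c).
Proof.
move=> sS Sb; rewrite /lincomb; elim/big_ind: _ => [|x y|i _].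
- exact: subspace0.
- exact: subspaceD.
- exact: subspaceZ.
Qed.

(** Uniqueness of the coordinates of a single vector, 0, already gives
    uniqueness for all of them. *)
Lemma has_codimP (W S : set E) n : is_subspace W -> S 0 ->
  has_codim W S n <-> exists b : 'I_n -> E, [/\ forall i, S (b i),
    forall x, S x -> exists c, W (x - lincomb b c) &
    forall c, W (lincomb b c) -> c = 0].
Proof.
move=> sW S0; split=> [[b [Sb bP]]|[b [Sb bS bW]]]; exists b; split=> //.
- by move=> x /bP [c [Wc _]]; exists c.
- move=> c Wc; case: (bP 0 S0) => d [_ d_uniq].
  rewrite -[c]opprK -(d_uniq (- c)) ?(d_uniq 0) ?oppr0 //.
    by rewrite sub0r -/(lincomb b 0) linear0 oppr0; apply: subspace0.
  by rewrite sub0r -/(lincomb b (- c)) linearN opprK.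
- move=> x /bS [c Wc]; exists c; split=> // d Wd.
  apply/eqP; rewrite -subr_eq0; apply/eqP/bW.
  rewrite linearB [X in W X](_ : _ = (x - lincomb b d) - (x - lincomb b c)).
    exact: subspaceB.
  by rewrite opprB [RHS]addrC addrA subrK.
Qed.

End LinearCombinations.

(** * Calculus of codimensions *)

Section Codimension.
Context {K : fieldType}.

(** The hypotheses say that f induces an isomorphism from S / W onto S' / W'.
    Restricting to subsets matters: the isomorphism theorems and the comparison
    of quotients living in different ambient spaces are all instances. *)
Lemma has_codim_transfer (E E' : lmodType K) (f : {linear E -> E'})
    (W S : set E) (W' S' : set E') n :
  is_subspace W -> is_subspace S -> is_subspace W' -> is_subspace S' ->
  (forall x, S x -> S' (f x)) ->
  (forall x, S x -> W' (f x) <-> W x) ->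
  (forall y, S' y -> exists2 x, S x & W' (y - f x)) ->
  has_codim W S n <-> has_codim W' S' n.
Proof.
move=> sW sS sW' sS' fS fW f_onto.
have f_lincomb b c : f (lincomb b c) = lincomb (f \o b) c :> E'.
  by rewrite /lincomb linear_sum; apply: eq_bigr => i _; rewrite linearZ.
rewrite !has_codimP; [|by []|exact: subspace0|by []|exact: subspace0].
split=> [[b [Sb bS bW]]|[b' [Sb' bS' bW']]].
(* A basis of S / W is pushed forward by f. *)
- exists (f \o b); split=> [i|y S'y|c].
  + exact: fS.
  + have [x Sx W'yx] := f_onto y S'y; have [c Wc] := bS x Sx; exists c.
    rewrite -f_lincomb -(subrK (f x) y) -addrA -linearB.
    apply: subspaceD => //; apply/fW => //.
    by apply: subspaceB => //; apply: subspace_lincomb.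
  + by rewrite -f_lincomb => /fW-/(_ (subspace_lincomb _ sS Sb)) /bW.
(* A basis of S' / W' is lifted, up to W', to vectors of S. *)
- have /choice [b bP] i : exists x, S x /\ W' (b' i - f x).
    by have [x ? ?] := f_onto _ (Sb' i); exists x.
  have Sb i : S (b i) by case: (bP i).
  have bb' c : W' (lincomb b' c - f (lincomb b c)).
    rewrite f_lincomb (_ : _ - _ = lincomb (fun i => b' i - f (b i)) c).
      by apply: subspace_lincomb => // i; case: (bP i).
    by rewrite /lincomb -sumrB; apply: eq_bigr => i _; rewrite scalerBr.
  exists b; split=> // [x Sx|c Wc].
  + have [c Wc] := bS' _ (fS x Sx); exists c.
    apply/fW; first by apply: subspaceB => //; apply: subspace_lincomb.
    rewrite linearB -(subrK (lincomb b' c) (f x)) -addrA.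
    exact: subspaceD.
  + apply: bW'; rewrite -(subrK (f (lincomb b c)) (lincomb b' c)).
    by apply: subspaceD => //; apply/fW => //; apply: subspace_lincomb.
Qed.

Section Tower.
Context {E : lmodType K}.
Implicit Types S W U : set E.

Lemma has_codim_trans W U S m n :
  is_subspace W -> is_subspace U -> is_subspace S -> W `<=` U -> U `<=` S ->
  has_codim W U m -> has_codim U S n -> has_codim W S (m + n)%N.
Proof.
move=> sW sU sS WU US.
move=> /has_codimP-/(_ sW (subspace0 sU)) [b [Ub bU bW]].
move=> /has_codimP-/(_ sU (subspace0 sS)) [d [Sd dS dU]].
pose bd (i : 'I_(m + n)) :=
  match fintype.split i with inl j => b j | inr j => d j end.
have bdE c : lincomb bd c = lincomb b (lsubmx c) + lincomb d (rsubmx c).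
  rewrite /lincomb big_split_ord; congr (_ + _); apply: eq_bigr => i _.
    by rewrite mxE /bd -[lshift n i]/(unsplit (inl i)) unsplitK.
  by rewrite mxE /bd -[rshift m i]/(unsplit (inr i)) unsplitK.
apply/has_codimP => //; first exact: subspace0.
exists bd; split=> [i|x Sx|c].
- by rewrite /bd; case: (fintype.split i) => j //; apply/US.
- have [cd Ux] := dS x Sx; have [cb Wx] := bU _ Ux.
  exists (row_mx cb cd); rewrite bdE row_mxKl row_mxKr.
  by rewrite opprD addrA addrAC.
- rewrite bdE => Wc.
  have c_r : rsubmx c = 0.
    apply: dU; rewrite -(addKr (lincomb b (lsubmx c)) (lincomb d _)) addrC.
    by apply: subspaceB => //; [exact: WU|exact: subspace_lincomb].
  move: Wc; rewrite c_r linear0 addr0 => /bW c_l.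
  by rewrite -[c]hsubmxK c_r c_l row_mx0.
Qed.

End Tower.

(** A matrix of maximal rank among those with rows in P: adding a vector v of P
    to its row space cannot increase the rank, so v is already there. *)
Lemma subspace_rowspace n (P : set 'rV[K]_n) : is_subspace P ->
  exists M : 'M[K]_n, forall v, P v <-> (v <= M)%MS.
Proof.
move=> sP.
pose inP (M : 'M[K]_n) := forall v, (v <= M)%MS -> P v.
have inP0 : inP 0 by move=> v; rewrite submx0 => /eqP ->; apply: subspace0.
have ex_r : exists r, `[< exists2 M, inP M & \rank M = r >].
  by exists (\rank (0 : 'M[K]_n)); apply/asboolP; exists 0.
have r_le r : `[< exists2 M, inP M & \rank M = r >] -> (r <= n)%N.
  by move=> /asboolP [M _ <-]; apply: rank_leq_row.
case: (ex_maxnP ex_r r_le) => r /asboolP [M MP rM] r_max.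
exists M => v; split=> [Pv|]; last exact: MP.
have inPD : inP (M + v)%MS.
  move=> w /sub_addsmxP [[u1 u2] /= ->]; apply: subspaceD => //.
    by apply: MP; apply: submxMl.
  by rewrite [u2]mx11_scalar mul_scalar_mx; apply: subspaceZ.
have rMv : (\rank (M + v)%MS <= \rank M)%N.
  by rewrite rM; apply: r_max; apply/asboolP; exists (M + v)%MS.
have := mxrank_leqif_sup (addsmxSl M v) => -[le_r eq_r].
have : (M + v <= M)%MS by rewrite -eq_r eqn_leq le_r rMv.
by rewrite addsmx_sub => /andP [].
Qed.

Lemma has_codim_rV n (P : set 'rV[K]_n) : is_subspace P ->
  exists2 r, (r <= n)%N & has_dim P r /\ has_codim P [set: 'rV[K]_n] (n - r)%N.
Proof.
move=> sP; have [M MP] := subspace_rowspace sP.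
exists (\rank M); first exact: rank_leq_row.
have row_lincomb m (B : 'M[K]_(m, n)) c : lincomb (fun i => row i B) c = c *m B.
  by rewrite mulmx_sum_row.
split.
- apply/has_codimP; [exact: subspace_set0|exact: subspace0|].
  exists (fun i => row i (row_base M)); split=> [i|v|c].
  + by apply/MP; rewrite -(eq_row_base M) row_sub.
  + move=> /MP; rewrite -(eq_row_base M) => vM; exists (v *m pinvmx (row_base M)).
    by rewrite row_lincomb mulmxKpV //= subrr.
  + rewrite row_lincomb /= -(mul0mx _ (row_base M)) => cB.
    exact: (row_free_inj (row_base_free M)).
- rewrite -mxrank_compl; apply/has_codimP => //.
  exists (fun i => row i (row_base M^C%MS)); split=> // [v _|c].
  + have /sub_addsmxP [[u1 u2] /= vE] : (v <= M + row_base M^C%MS)%MS.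
      rewrite (adds_eqmx (eqmx_refl M) (eq_row_base _)) submx_full //.
      exact: addsmx_compl_full.
    by exists u2; rewrite row_lincomb vE addrK; apply/MP/submxMl.
  + rewrite row_lincomb => /MP cM.
    apply: (row_free_inj (row_base_free M^C%MS)); rewrite mul0mx.
    apply/eqP; rewrite -submx0 -(capmx_compl M) sub_capmx cM /=.
    by rewrite -(eq_row_base M^C%MS) submxMl.
Qed.

(** The matrix of a basis of m vectors is both row free and row full. *)
Lemma has_dim_rV n m : has_dim [set: 'rV[K]_n] m -> m = n.
Proof.
move=> /has_codimP-/(_ subspace_set0 I) [b [_ bS bW]].
pose B := \matrix_i b i.
have BE c : lincomb b c = c *m B.
  by rewrite mulmx_sum_row; apply: eq_bigr => i _; rewrite rowK.
have B_free : row_free B.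
  by apply/inj_row_free => v vB; apply: bW; rewrite /= BE.
have B_full : row_full B.
  rewrite -sub1mx; apply/row_subP => i; have [c] := bS (row i 1%:M) I.
  by rewrite /= BE => /eqP; rewrite subr_eq0 => /eqP ->; apply: submxMl.
by rewrite -(eqP B_free) (eqP B_full).
Qed.

Section Quotient.
Context {E : lmodType K}.
Implicit Types S W U : set E.

(** Coordinates modulo W identify S / W with a space of row vectors, in which
    U / W becomes a row space; this reduces the claim to [has_codim_rV]. *)
Lemma has_codim_split W U S n :
  is_subspace W -> is_subspace U -> is_subspace S -> W `<=` U -> U `<=` S ->
  has_codim W S n ->
  exists m1 m2, [/\ n = (m1 + m2)%N, has_codim W U m1 & has_codim U S m2].
Proof.
move=> sW sU sS WU US /has_codimP-/(_ sW (subspace0 sS)) [b [Sb bS bW]].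
have sP := subspace_preimage (lincomb b) sU.
have bW_eq c : W (lincomb b c) <-> [set 0] c.
  by split=> [/bW|->] //; rewrite linear0; apply: subspace0.
have [r rn [dimP codimP]] := has_codim_rV sP.
exists r, (n - r)%N; split; first by rewrite subnKC.
- apply: (proj1 (has_codim_transfer (f := lincomb b) _
    subspace_set0 sP sW sU _ (fun c _ => bW_eq c) _)) dimP => //.
  move=> y Uy; have [c Wc] := bS y (US _ Uy); exists c => //=.
  by rewrite -(subKr y (lincomb b c)); apply: subspaceB => //; apply: WU.
- apply: (proj1 (has_codim_transfer (f := lincomb b) _
    sP subspace_setT sU sS _ _ _)) codimP => //.
  + by move=> c _; apply: subspace_lincomb.
  + by move=> y /bS [c Wc]; exists c => //; apply: WU.
Qed.

Lemma has_codim_uniq W S m n : is_subspace W -> is_subspace S ->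
  has_codim W S m -> has_codim W S n -> m = n.
Proof.
move=> sW sS /has_codimP-/(_ sW (subspace0 sS)) [b [Sb bS bW]] Sn.
apply/esym/has_dim_rV.
apply: (proj2 (has_codim_transfer (f := lincomb b) _
  subspace_set0 subspace_setT sW sS _ _ _)) Sn => //.
- by move=> c _; apply: subspace_lincomb.
- by move=> c _; split=> [/bW|->] //; rewrite linear0; apply: subspace0.
- by move=> y /bS [c Wc]; exists c.
Qed.

Lemma has_codim_refl W : is_subspace W -> has_codim W W 0.
Proof.
move=> sW; apply/has_codimP => //; first exact: subspace0.
exists (fun=> 0); split=> [[]//|x Wx|c _]; last exact: thinmx0.
by exists 0; rewrite linear0 subr0.
Qed.

(** Second isomorphism theorem: U / (U `&` W) = (U + W) / W. *)
Lemma has_codim_sum U W n : is_subspace U -> is_subspace W ->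
  has_codim (U `&` W) U n <-> has_codim W (sum_subspaces U W) n.
Proof.
move=> sU sW.
apply: (has_codim_transfer (f := idfun)) => //=.
- exact: subspaceI.
- exact: subspace_sum.
- exact: sub_suml.
- by move=> x Ux; split=> [|[]].
- by move=> _ [u Uu [w Ww <-]]; exists u => //; rewrite addrAC subrr add0r.
Qed.

Definition line u : set E := [set a *: u | a in [set: K]].

Lemma subspace_line u : is_subspace (line u).
Proof.
apply/is_subspaceP; split; first by exists 0; rewrite ?scale0r.
move=> a _ _ [b _ <-] [c _ <-]; exists (a * b + c) => //.
by rewrite scalerDl scalerA.
Qed.

Lemma has_codim_line W u : is_subspace W -> ~ W u ->
  has_codim W (sum_subspaces W (line u)) 1.
Proof.
move=> sW Wu; have sL := subspace_line u; have sWL := subspace_sum sW sL.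
have u_lincomb c : lincomb (fun _ : 'I_1 => u) c = c 0 0 *: u.
  by rewrite /lincomb big_ord1.
apply/has_codimP => //; first exact: subspace0.
exists (fun=> u); split=> [_|_ [w Ww [_ [a _ <-] <-]]|c].
- by apply: sub_sumr => //; exists 1; rewrite ?scale1r.
- by exists a%:M; rewrite u_lincomb !mxE eqxx mulr1n addrK.
- rewrite u_lincomb => Wcu; apply/rowP => i; rewrite ord1 mxE.
  apply/eqP; apply: contra_notT Wu => c_neq0.
  rewrite -(scale1r u) -(mulVf c_neq0) -scalerA.
  exact: subspaceZ.
Qed.

(** The intermediate space is M = (V `&` W) + U, which by the modular law equals
    V `&` (U + W). The second isomorphism theorem turns M / U into
    (V `&` W) / (U `&` W), and V / M into (V + W) / (U + W). *)
Lemma has_codim_cap_sum U V W n : is_subspace U -> is_subspace V ->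
  is_subspace W -> U `<=` V -> has_codim U V n ->
  exists a b, [/\ n = (a + b)%N, has_codim (U `&` W) (V `&` W) a &
    has_codim (sum_subspaces U W) (sum_subspaces V W) b].
Proof.
move=> sU sV sW UV UVn.
have sVW := subspaceI sV sW; have sUW := subspace_sum sU sW.
have sM := subspace_sum sVW sU.
have UM : U `<=` sum_subspaces (V `&` W) U := sub_sumr sVW.
have MV : sum_subspaces (V `&` W) U `<=` V by apply: sum_sub => // x [].
have [a [b [nE Ma Mb]]] := has_codim_split sU sM sV UM MV UVn.
exists a, b; split=> //.
- move/(has_codim_sum _ sVW sU): Ma.
  by rewrite setIAC (setIidr UV).
- have modular : sum_subspaces (V `&` W) U = V `&` sum_subspaces U W.
    apply/seteqP; split=> [_ [x [Vx Wx] [y Uy <-]]|z [Vz [x Ux [y Wy zE]]]].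
      split; first by apply: subspaceD => //; apply: UV.
      by exists y => //; exists x => //; rewrite addrC.
    exists y; last by exists x => //; rewrite addrC.
    split=> //; have := subspaceB sV Vz (UV _ Ux).
    by rewrite -zE addrAC subrr add0r.
  have -> : sum_subspaces V W = sum_subspaces V (sum_subspaces U W).
    apply/seteqP; split.
      apply: sum_sub; [exact: subspace_sum|exact: sub_suml|].
      exact: subset_trans (sub_sumr sU) (sub_sumr sV).
    apply: sum_sub; [exact: subspace_sum|exact: sub_suml|].
    apply: sum_sub; [exact: subspace_sum| |exact: sub_sumr].
    exact: subset_trans UV (sub_suml sW).
  by apply/(has_codim_sum _ sV sUW); rewrite -modular.
Qed.

End Quotient.
End Codimension.

(** * The excess and the relative dimension *)

Section Excess.
Context {K : fieldType} {E : lmodType K}.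
Implicit Types S U V W : set E.

Lemma sum_subspacesC U V : sum_subspaces U V = sum_subspaces V U.
Proof.
apply/seteqP.
by split=> _ [x ? [y ? <-]]; exists y => //; exists x => //; rewrite addrC.
Qed.

Lemma excessC S U V d :
  quasi_complementary_excess S U V d -> quasi_complementary_excess S V U d.
Proof. by move=> [US VS]; rewrite setIC sum_subspacesC. Qed.

Lemma excess_codim S U V W (k : nat) (d : int) :
  is_subspace S -> is_subspace U -> is_subspace V -> is_subspace W ->
  U `<=` V -> V `<=` S -> has_codim U V k ->
  quasi_complementary_excess S U W d <->
  quasi_complementary_excess S V W (d + k%:Z).
Proof.
move=> sS sU sV sW UV VS UVk.
have [a [b [kE cap_a sum_b]]] := has_codim_cap_sum sU sV sW UV UVk.
have [sUW sVW sU'W sV'W] : [/\ is_subspace (U `&` W), is_subspace (V `&` W),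
    is_subspace (sum_subspaces U W) & is_subspace (sum_subspaces V W)].
  by split; (apply: subspaceI || apply: subspace_sum).
have s0 := @subspace_set0 _ E.
have UW_VW : U `&` W `<=` V `&` W by apply: setSI.
have UpW_VpW : sum_subspaces U W `<=` sum_subspaces V W.
  apply: sum_sub => //; last exact: sub_sumr.
  exact: subset_trans UV (sub_suml sW).
have zero_sub X : is_subspace X -> [set 0 : E] `<=` X.
  by move=> sX _ ->; apply: subspace0.
split=> [[US WS [n [m [UWn UWm dE]]]]|[_ WS [n [m [VWn VWm dE]]]]].
- split=> //.
  have VpWS : sum_subspaces V W `<=` S by apply: sum_sub.
  have [b' [m' [mE b'b VWm]]] := has_codim_split sU'W sV'W sS UpW_VpW VpWS UWm.
  exists (n + a)%N, m'; split=> //.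
    exact: (has_codim_trans s0 sUW sVW (zero_sub _ sUW) UW_VW).
  rewrite dE mE kE (has_codim_uniq sU'W sV'W b'b sum_b) !PoszD. ring.
- have US := subset_trans UV VS.
  split=> //.
  have VpWS : sum_subspaces V W `<=` S by apply: sum_sub.
  have [n' [a' [nE UWn a'a]]] :=
    has_codim_split s0 sUW sVW (zero_sub _ sUW) UW_VW VWn.
  exists n', (b + m)%N; split=> //.
    exact: (has_codim_trans sU'W sV'W sS UpW_VpW VpWS).
  rewrite -(addrK k%:Z d) dE nE kE (has_codim_uniq sUW sVW a'a cap_a) !PoszD; ring.
Qed.

Lemma excess_comparable S V G W (d e : int) :
  is_subspace S -> is_subspace V -> is_subspace G -> is_subspace W ->
  V `<=` S -> comparable_reldim V G d ->
  quasi_complementary_excess S G W e ->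
  quasi_complementary_excess S V W (e + d).
Proof.
move=> sS sV sG sW VS [n1 [n2 [Vn1 Gn2 dE]]] exG.
have sVG := subspaceI sV sG; have [GS _ _] := exG.
have VGV : V `&` G `<=` V by move=> x [].
have VGG : V `&` G `<=` G by move=> x [].
have exVG : quasi_complementary_excess S (V `&` G) W (e - n2%:Z).
  by apply/(excess_codim _ sS sVG sG sW VGG GS Gn2); rewrite subrK.
have := exVG => /(excess_codim _ sS sVG sV sW VGV VS Vn1).
by rewrite dE (addrC n1%:Z) addrA.
Qed.

End Excess.

(** * Scalars *)

Section Scalars.
Context {R : realType} {s : scalars}.
Local Notation K := (scalar_field R s).

(** [of_real] and [modulus] treat real and complex scalars alike: they
    translate between norms, with values in the scalars, and real numbers. *)
Definition of_real : R -> K :=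
  match s return R -> scalar_field R s with
  | RealScalars => id
  | ComplexScalars => fun r => (r%:C)%C
  end.

Definition modulus : K -> R :=
  match s return scalar_field R s -> R with
  | RealScalars => fun a => `|a|
  | ComplexScalars => fun a => complex.Re `|a|
  end.

Lemma of_real_modulus a : of_real (modulus a) = `|a|.
Proof.
by rewrite /of_real /modulus; move: a; case: s.
Qed.

Lemma of_real_le x y : (of_real x <= of_real y) = (x <= y).
Proof. by rewrite /of_real; case: s => //=; rewrite lecR. Qed.

Lemma of_real_lt x y : (of_real x < of_real y) = (x < y).
Proof. by rewrite /of_real; case: s => //=; rewrite ltcR. Qed.

Lemma of_real0 : of_real 0 = 0.
Proof. by rewrite /of_real; case: s. Qed.

Lemma of_realD x y : of_real (x + y) = of_real x + of_real y.
Proof. by rewrite /of_real; case: s => //=; rewrite rmorphD. Qed.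

Lemma of_realM x y : of_real (x * y) = of_real x * of_real y.
Proof. by rewrite /of_real; case: s => //=; rewrite rmorphM. Qed.

Lemma of_real_inj : injective of_real.
Proof. by move=> x y xy; apply: le_anti; rewrite -!of_real_le xy lexx. Qed.

Lemma modulus_of_real x : modulus (of_real x) = `|x|.
Proof.
apply: of_real_inj; rewrite of_real_modulus.
have [x0|x0] := ger0P x; first by rewrite ger0_norm // -of_real0 of_real_le.
rewrite ltr0_norm; last by rewrite -of_real0 of_real_lt.
by apply/eqP; rewrite eqr_oppLR -subr_eq0 opprK -of_realD subrr of_real0.
Qed.

Lemma modulusN a : modulus (- a) = modulus a.
Proof. by apply: of_real_inj; rewrite !of_real_modulus normrN. Qed.

Lemma modulus0 : modulus 0 = 0.
Proof. by apply: of_real_inj; rewrite of_real_modulus normr0 of_real0. Qed.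

Lemma modulus1 : modulus 1 = 1.
Proof. by apply: of_real_inj; rewrite of_real_modulus normr1 /of_real; case: s. Qed.

Lemma modulus_ge0 a : 0 <= modulus a.
Proof. by rewrite -of_real_le of_real0 of_real_modulus. Qed.

End Scalars.

Lemma real_complete (R : realType) (a : nat -> R) :
  (forall e : R, 0 < e -> exists n0, forall m n, (n0 <= m)%N -> (n0 <= n)%N ->
    `|a m - a n| < e) ->
  exists l, forall e : R, 0 < e -> exists n0, forall n, (n0 <= n)%N ->
    `|a n - l| < e.
Proof.
move=> a_cauchy.
have : cvg (a @ \oo).
  apply/cauchy_cvgP/cauchy_exP => e e0.
  have [n0 n0P] := a_cauchy e e0; exists (a n0).
  exists n0 => // n /= n0n; exact: n0P.
move=> /cvg_ex [l /cvgrPdist_lt al]; exists l => e /al [n0 _ n0P].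
by exists n0 => n /n0P /=; rewrite distrC.
Qed.

Lemma scalar_complete (R : realType) (s : scalars)
    (a : nat -> scalar_field R s) :
  (forall e : R, 0 < e -> exists n0, forall m n, (n0 <= m)%N -> (n0 <= n)%N ->
    modulus (a m - a n) < e) ->
  exists l, forall e : R, 0 < e -> exists n0, forall n, (n0 <= n)%N ->
    modulus (a n - l) < e.
Proof.
case: s a => /= a a_cauchy; first exact: real_complete.
(* The real and the imaginary parts of a are Cauchy sequences. *)
have part (f : R[i] -> R) : {morph f : x y / x - y} ->
    (forall z, `|f z| <= modulus (s := ComplexScalars) z) ->
    exists l, forall e : R, 0 < e -> exists n0, forall n, (n0 <= n)%N ->
    `|f (a n) - l| < e.
  move=> fB f_le; apply: real_complete => e /a_cauchy [n0 n0P].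
  exists n0 => m n n0m n0n.
  by rewrite -fB; apply: le_lt_trans (f_le _) (n0P _ _ n0m n0n).
have ReIm (z : R[i]) :
    `|complex.Re z| <= complex.Re `|z| /\ `|complex.Im z| <= complex.Re `|z|.
  case: z => x y /=; split; rewrite -sqrtr_sqr ler_wsqrtr ?lerDl ?lerDr ?sqr_ge0 //.
have ReB : {morph @complex.Re R : z w / z - w} by case=> ? ? [].
have ImB : {morph @complex.Im R : z w / z - w} by case=> ? ? [].
have [x xP] := part _ ReB (fun z => (ReIm z).1).
have [y yP] := part _ ImB (fun z => (ReIm z).2).
exists (x +i* y)%C => e e0.
have e2 : 0 < e / 2 by lra.
have [n1 n1P] := xP _ e2; have [n2 n2P] := yP _ e2.
exists (maxn n1 n2) => n; rewrite geq_max => /andP [/n1P + /n2P].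
case: (a n) => u v /= ux vy.
apply: (@le_lt_trans _ _ (`|u - x| + `|v - y|)); last by lra.
rewrite -[leRHS]ger0_norm ?addr_ge0 // -sqrtr_sqr ler_wsqrtr //.
by rewrite [leRHS]sqrrD !real_normK ?num_real // addrAC lerDl mulrn_wge0 ?mulr_ge0.
Qed.

(** * Normed spaces *)

(** Closed subspaces are described below by approximation up to every e > 0, so
    that no topology has to be put on E; the same vector space can then be
    considered with several norms. *)
Record vector_norm (R : realType) (s : scalars)
    (E : lmodType (scalar_field R s)) := VectorNorm {
  vnorm :> E -> R;
  vnormZ : forall a x, vnorm (a *: x) = modulus a * vnorm x;
  vnormD : forall x y, vnorm (x + y) <= vnorm x + vnorm y;
  vnorm_eq0 : forall x, vnorm x = 0 -> x = 0 }.

Lemma harmonic_small (R : realType) (e : R) : 0 < e ->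
  exists n0, forall n, (n0 <= n)%N -> n.+1%:R^-1 < e.
Proof.
move: e => _/posnumP[e].
by have [n0 _ n0P] := near_infty_natSinv_lt e; exists n0.
Qed.

Section NormedTopology.
Context {R : realType} {s : scalars} {E : lmodType (scalar_field R s)}.
Context (N : vector_norm E).
Implicit Types (M : set E) (f : E -> E).

Lemma vnorm0 : N 0 = 0.
Proof. by rewrite -(scale0r 0) vnormZ modulus0 mul0r. Qed.

Lemma vnormN x : N (- x) = N x.
Proof. by rewrite -scaleN1r vnormZ modulusN modulus1 mul1r. Qed.

Lemma vnormBC x y : N (x - y) = N (y - x).
Proof. by rewrite -vnormN opprB. Qed.

Lemma vnormB_le x y z : N (x - z) <= N (x - y) + N (y - z).
Proof. by rewrite -[x - z](subrKA y); apply: vnormD. Qed.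

Lemma vnorm_ge0 x : 0 <= N x.
Proof.
by have := vnormB_le x 0 x; rewrite subrr vnorm0 sub0r vnormN subr0; lra.
Qed.

Lemma vnorm_le_dist x y : N x <= N (x - y) + N y.
Proof. by rewrite -{1}[x](subrK y); apply: vnormD. Qed.

Lemma vnorm_small0 x : (forall e : R, 0 < e -> N x < e) -> x = 0.
Proof.
move=> x_small; apply: (vnorm_eq0 (v := N)).
apply/eqP; rewrite eq_le vnorm_ge0 andbT.
by rewrite leNgt; apply/negP => /x_small; rewrite ltxx.
Qed.

Definition vclosed M := forall x,
  (forall e : R, 0 < e -> exists2 m, M m & N (x - m) < e) -> M x.

Lemma vclosed_set0 : vclosed [set 0].
Proof.
by move=> x adh; apply: vnorm_small0 => e /adh [_ -> ]; rewrite subr0.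
Qed.

Lemma vclosed_dist M x : vclosed M -> ~ M x ->
  exists2 d : R, 0 < d & forall m, M m -> d <= N (x - m).
Proof.
move=> cM Mx; apply: contra_notP Mx => noD; apply: cM => e e0.
apply: contrapT => far; apply: noD; exists e => // m Mm.
by rewrite leNgt; apply/negP => me; apply: far; exists m.
Qed.

(** Lemma of Riesz. The point m of M is chosen so that N (x - m) is less than
    twice the distance from x to M; dividing x - m by its norm leaves it at
    distance more than 1/2 from M. *)
Lemma riesz_lemma M x : is_subspace M -> vclosed M -> ~ M x ->
  exists a m, [/\ M m, N (a *: (x - m)) = 1 &
    forall z, M z -> 2^-1 <= N (a *: (x - m) - z)].
Proof.
move=> sM cM Mx; have [d d0 dP] := vclosed_dist cM Mx.
pose D := [set N (x - m) | m in M].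
have D_inf : has_inf D.
  split; first by exists (N (x - 0)), 0 => //; apply: subspace0.
  by exists d => _ [m Mm <-]; apply: dP.
have dD : d <= inf D.
  by apply: lb_le_inf; [case: D_inf|move=> _ [m Mm <-]; apply: dP].
have [_ [m Mm <-] m_near] := inf_adherent (lt_le_trans d0 dD) D_inf.
have D_lb z : M z -> inf D <= N (x - z).
  by move=> Mz; apply: ge_inf; [case: D_inf|exists z].
set r := N (x - m) in m_near.
have r0 : 0 < r by have := D_lb m Mm; rewrite -/r; lra.
have mod_r : modulus (of_real r^-1 : scalar_field R s) = r^-1.
  by rewrite modulus_of_real ger0_norm // invr_ge0 ltW.
exists (of_real r^-1), m; split=> [//||z Mz].
  by rewrite vnormZ mod_r -/r mulVf // gt_eqF.
have r_inv : of_real r^-1 * of_real r = 1 :> scalar_field R s.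
  by rewrite -of_realM mulVf ?gt_eqF // /of_real; case: (s).
rewrite -[z]scale1r -r_inv -scalerA -scalerBr vnormZ mod_r -addrA -opprD.
have /D_lb := subspaceD sM Mm (subspaceZ (of_real r) sM Mz).
move=> near; rewrite -(ler_pM2l r0) mulrA divff ?gt_eqF // mul1r.
lra.
Qed.

(** If y is approximated by m_n + a_n b with m_n in M, then the scalars a_n form
    a Cauchy sequence, as the distance d from b to M is positive; with l their
    limit, m_n approximates y - l b. Completeness of the scalars is used
    here. *)
Lemma vclosed_line M b : is_subspace M -> vclosed M ->
  vclosed (sum_subspaces M (line b)).
Proof.
move=> sM cM y adh; have [Mb|Mb] := pselect (M b).
  apply: sub_suml; first exact: subspace_line.
  apply: cM => e /adh [_ [m Mm [_ [a _ <-] <-]]] me; exists (m + a *: b) => //.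
  by apply: subspaceD => //; apply: subspaceZ.
have [d d0 dP] := vclosed_dist cM Mb.
have /choice [ma maP] n : exists ma : E * scalar_field R s,
    M ma.1 /\ N (y - (ma.1 + ma.2 *: b)) < n.+1%:R^-1.
  have [|_ [m Mm [_ [a _ <-] <-]] mn] := adh n.+1%:R^-1; first by rewrite invr_gt0.
  by exists (m, a).
pose a n := (ma n).2.
have a_dist c m : M m -> modulus c * d <= N (c *: b - m).
  move=> Mm; have [->|c0] := eqVneq c 0.
    by rewrite modulus0 mul0r vnorm_ge0.
  rewrite -[m]scale1r -(mulfV c0) -scalerA -scalerBr vnormZ.
  by apply: ler_wpM2l; [exact: modulus_ge0|by apply: dP; apply: subspaceZ].
have [l al] : exists l, forall e : R, 0 < e ->
    exists n0, forall n, (n0 <= n)%N ->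
    modulus (a n - l) < e.
  apply: scalar_complete => e e0.
  have ed : 0 < e * d / 2 by rewrite divr_gt0 ?mulr_gt0.
  have [n0 n0P] := harmonic_small ed; exists n0 => i j /n0P i_small /n0P j_small.
  rewrite -(ltr_pM2r d0).
  have Mij : M ((ma j).1 - (ma i).1).
    by apply: subspaceB => //; [case: (maP j)|case: (maP i)].
  apply: (le_lt_trans (a_dist _ _ Mij)).
  have [[_ yi] [_ yj]] := (maP i, maP j).
  rewrite scalerBl opprB addrC addrACA -opprD.
  apply: (le_lt_trans (vnormB_le _ y _)); rewrite vnormBC /a.
  have := lt_trans yi i_small; have := lt_trans yj j_small; lra.
exists (y - l *: b); last by exists (l *: b); [exists l|rewrite subrK].
apply: cM => e e0.
have b0 : 0 < N b + 1 by rewrite ltr_wpDl ?vnorm_ge0.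
have eb : 0 < e / 2 / (N b + 1) by rewrite !divr_gt0.
have e2 : 0 < e / 2 by rewrite divr_gt0.
have [n1 n1P] := harmonic_small e2; have [n2 n2P] := al _ eb.
pose n := maxn n1 n2; have [Mn yn] := maP n; exists (ma n).1 => //.
have -> : y - l *: b - (ma n).1 = y - ((ma n).1 + a n *: b) + (a n - l) *: b.
  by rewrite scalerBl addrA opprD addrA subrK addrAC.
apply: (le_lt_trans (vnormD _ _ _)); rewrite vnormZ.
have := n1P n (leq_maxl _ _); have := n2P n (leq_maxr _ _).
rewrite ltr_pdivlMr // => al_n1 n1_small.
have := modulus_ge0 (a n - l); have := lt_trans yn n1_small.
rewrite /a in al_n1 *; lra.
Qed.

End NormedTopology.

(** * Compact operators *)

Section Operators.
Context {R : realType} {s : scalars} {E : lmodType (scalar_field R s)}.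
Context (N : vector_norm E).
Implicit Types (M : set E) (T f : {linear E -> E}).

Definition vbounded (f : E -> E) :=
  exists2 C : R, 0 < C & forall x, N (f x) <= C * N x.

(** The image of a bounded sequence has a cluster point. This is sequential
    compactness with the subsequence left implicit. *)
Definition compact_op (T : E -> E) := forall u : nat -> E,
  (exists M : R, forall n, N (u n) <= M) ->
  exists w, forall e : R, 0 < e -> forall n0, exists2 n, (n0 <= n)%N &
    N (T (u n) - w) < e.

Lemma compact_op_bounded T : compact_op T -> vbounded T.
Proof.
move=> cT; apply: contrapT => unbounded.
have /choice [u uP] n : exists x, N x = 1 /\ n.+1%:R < N (T x).
  apply: contrapT => noX; apply: unbounded; exists n.+1%:R => // x.
  rewrite leNgt; apply/negP => Tx; apply: noX.
  have Nx : 0 < N x.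
    rewrite lt_def vnorm_ge0 andbT; apply: contraTneq Tx => /vnorm_eq0 ->.
    by rewrite linear0 vnorm0 mulr0 ltxx.
  have mod_inv : modulus (of_real (N x)^-1 : scalar_field R s) = (N x)^-1.
    by rewrite modulus_of_real ger0_norm // invr_ge0 ltW.
  exists (of_real (N x)^-1 *: x); rewrite linearZ !vnormZ mod_inv.
  by rewrite mulVf ?gt_eqF // -(ltr_pM2l Nx) mulrA divff ?gt_eqF // mul1r mulrC.
have [|w wP] := cT u; first by exists 1 => n; case: (uP n) => ->.
have [n0 n0P] : exists n0 : nat, N w + 1 < n0%:R.
  by exists (Num.bound (N w + 1)); apply: archi_boundP; rewrite addr_ge0 ?vnorm_ge0.
have [n n0n Tw] := wP 1 ltr01 n0; have [_ Tn] := uP n.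
have : n0%:R <= n%:R :> R by rewrite ler_nat.
have := vnorm_le_dist N (T (u n)) w; rewrite mulrSr in Tn; lra.
Qed.

Lemma vclosed_ker f : vbounded f -> vclosed N [set x | f x = 0].
Proof.
move=> [C C0 fC] x adh; rewrite /=; apply: (vnorm_small0 (N := N)) => e e0.
have [|m /= fm mx] := adh (e / C); first exact: divr_gt0.
rewrite -[f x]subr0 -fm -linearB; apply: le_lt_trans (fC _) _.
by rewrite mulrC -ltr_pdivlMr.
Qed.

(** Let u n be a unit vector of A n at distance at least 1/2 from B n. If A j is
    contained in B i, then T (u i) - T (u j) differs from u i by an element of
    B i, hence has norm at least 1/2, which compactness forbids. Both
    increasing and decreasing chains have this form. *)
Lemma riesz_chain T (A B : nat -> set E) : compact_op T ->
  (forall n, is_subspace (A n)) -> (forall n, is_subspace (B n)) ->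
  (forall n, vclosed N (B n)) -> (forall n, B n `<=` A n) ->
  (forall n, exists2 x, A n x & ~ B n x) ->
  (forall n x, A n x -> B n (x - T x)) ->
  (forall i j, (i < j)%N -> A i `<=` B j \/ A j `<=` B i) ->
  False.
Proof.
move=> cT sA sB cB BA A_B AT chain.
have /choice [u uP] n : exists x, [/\ A n x, N x = 1 &
    forall z, B n z -> 2^-1 <= N (x - z)].
  have [x Ax Bx] := A_B n.
  have [a [m [Bm Nx far]]] := riesz_lemma (sB n) (cB n) Bx.
  exists (a *: (x - m)); split=> //; apply: subspaceZ => //.
  by apply: subspaceB => //; apply: BA.
have sep i j : A j `<=` B i -> 2^-1 <= N (T (u i) - T (u j)).
  move=> AB; have [Ai _ far] := uP i; have [Aj _ _] := uP j.
  have -> : T (u i) - T (u j) = u i - ((u i - T (u i)) + (u j - (u j - T (u j)))).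
    by rewrite subKr opprD addrA subKr.
  apply: far; apply: subspaceD => //; first exact: AT.
  apply: subspaceB => //; first exact: AB.
  exact/AB/BA/AT.
have [|w wP] := cT u; first by exists 1 => n; case: (uP n) => _ ->.
have e4 : 0 < 4^-1 :> R by [].
have [i _ iw] := wP _ e4 0; have [j ij jw] := wP _ e4 i.+1.
have far : 2^-1 <= N (T (u i) - T (u j)).
  by have [AB|AB] := chain i j ij; [rewrite vnormBC; apply: sep|apply: sep].
have := vnormB_le N (T (u i)) w (T (u j)); rewrite [N (w - _)]vnormBC; lra.
Qed.

(** If ker (1 - T) has infinite dimension, adding vectors one at a time yields a
    strictly increasing chain of finite-dimensional subspaces of it, which are
    closed by [vclosed_line]. *)
Lemma ker_has_dim T : compact_op T -> exists n, has_dim [set x | x - T x = 0] n.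
Proof.
move=> cT; pose S : {linear E -> E} := idfun \- T; pose ker := [set x | S x = 0].
have sker : is_subspace ker := subspace_ker S.
apply: contrapT => inf_dim.
pose good P := [/\ is_subspace P, vclosed N P, P `<=` ker & exists n, has_dim P n].
have step (P : {P | good P}) : exists Q : {P | good P},
    sval P `<=` sval Q /\ exists2 b, sval Q b & ~ sval P b.
  case: P => P [sP cP Pker [n Pn]] /=.
  have [b kb Pb] : exists2 b, ker b & ~ P b.
    apply: contrapT => noB; apply: inf_dim; exists n.
    rewrite (_ : mkset _ = P) //; apply/seteqP; split=> // x kx.
    by apply: contrapT => Px; apply: noB; exists x.
  have sL := subspace_line b.
  have goodQ : good (sum_subspaces P (line b)).
    split; [exact: subspace_sum|exact: vclosed_line| |].
      by apply: sum_sub => // _ [a _ <-]; apply: subspaceZ.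
    exists (n + 1)%N; apply: has_codim_trans (sub_suml sL) Pn _ => //.
    - exact: subspace_set0.
    - exact: subspace_sum.
    - by move=> _ ->; apply: subspace0.
    - exact: has_codim_line.
  exists (exist _ _ goodQ); split=> /=; first exact: sub_suml.
  by exists b => //; apply: sub_sumr => //; exists 1; rewrite ?scale1r.
have [next nextP] := choice step.
have good0 : good [set 0].
  split; [exact: subspace_set0|exact: vclosed_set0| |].
    by move=> _ ->; apply: subspace0.
  by exists 0; apply/has_codim_refl/subspace_set0.
pose C n : {P | good P} := iter n next (exist _ _ good0).
have C_mono i j : (i <= j)%N -> sval (C i) `<=` sval (C j).
  move=> /subnK <-; elim: (j - i)%N => // k IH.
  by apply: subset_trans IH _; case: (nextP (C (k + i)%N)).
apply: (@riesz_chain T (fun n => sval (C n.+1)) (fun n => sval (C n))) => //.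
- by move=> n; case: (C n.+1) => P [].
- by move=> n; case: (C n) => P [].
- by move=> n; case: (C n) => P [].
- by move=> n; apply: C_mono.
- by move=> n; case: (nextP (C n)).
- move=> n x Cx; have -> : x - T x = 0.
    by move: Cx; case: (C n.+1) => Q [sQ cQ Qker Qn] /= /Qker.
  by case: (C n) => P [sP cP Pker Pn]; apply: subspace0.
- by move=> i j ij; left; apply: C_mono.
Qed.

(** Write S = 1 - T. The point is that S is bounded below modulo its
    kernel: x is at distance at most c * N (S x) from ker S. Hence a vector y in
    the closure of the range is a limit of S (u n) with u bounded; if w is a
    cluster point of T (u n), then u n = S (u n) + T (u n) clusters at y + w,
    and S (y + w) = y. *)
Lemma vclosed_range T : compact_op T -> vclosed N (range (fun x => x - T x)).
Proof.
move=> cT; have [S SE] : exists S : {linear E -> E}, forall x, S x = x - T x.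
  by exists (idfun \- T).
pose ker := [set x | S x = 0].
have [C C0 TC] := compact_op_bounded cT.
have SC x : N (S x) <= (1 + C) * N x.
  by rewrite SE; apply: le_trans (vnormD _ _ _) _; rewrite vnormN mulrDl mul1r lerD2l.
have S_bounded : vbounded S by exists (1 + C); [lra|exact: SC].
have sker : is_subspace ker := subspace_ker S.
have cker : vclosed N ker := vclosed_ker S_bounded.
(* Otherwise there are unit vectors u n far from ker S with S (u n) tending to
   0. A cluster point w of T (u n) is then one of u n, so that w is in ker S,
   but u n comes close to it. *)
have [c c0 cP] : exists2 c : R, 0 < c & forall x,
    exists2 z, ker z & N (x - z) <= c * N (S x).
  apply: contrapT => noC.
  have /choice [u uP] n : exists x, [/\ N x = 1, N (S x) < n.+1%:R^-1 &
      forall z, ker z -> 2^-1 <= N (x - z)].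
    have [x xP] : exists x, forall z, ker z -> n.+1%:R * N (S x) < N (x - z).
      apply: contrapT => noX; apply: noC; exists n.+1%:R => // x.
      apply: contrapT => noZ; apply: noX; exists x => z kz.
      by rewrite ltNge; apply/negP => xz; apply: noZ; exists z.
    have kx : ~ ker x.
      by move=> kx; have := xP x kx; rewrite kx subrr vnorm0 mulr0 ltxx.
    have [a [m [km Nx far]]] := riesz_lemma sker cker kx.
    exists (a *: (x - m)); split=> //.
    have a0 : 0 < modulus a.
      rewrite lt_def modulus_ge0 andbT; apply: contra_eq_neq Nx => a0.
      by rewrite vnormZ a0 mul0r eq_sym oner_eq0.
    rewrite linearZ linearB km subr0 -[ltRHS]mul1r -ltr_pdivrMr ?invr_gt0 // invrK.
    rewrite -[ltRHS]Nx !vnormZ -mulrA ltr_pM2l // mulrC; exact: xP.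
  have [|w wP] := cT u; first by exists 1 => n; case: (uP n) => ->.
  have u_w e : 0 < e -> exists n, N (u n - w) < e /\ N (S (u n)) < e.
    move=> e0; have e2 : 0 < e / 2 by rewrite divr_gt0.
    have [n0 n0P] := harmonic_small e2; have [n /n0P n_small Tw] := wP _ e2 n0.
    exists n; have [_ Sn _] := uP n; have S_small := lt_trans Sn n_small.
    split; last by lra.
    have -> : u n - w = S (u n) + (T (u n) - w) by rewrite SE addrA subrK.
    by apply: (le_lt_trans (vnormD _ _ _)); lra.
  have kw : S w = 0.
    apply: (vnorm_small0 (N := N)) => e e0.
    have D0 : 0 < 2 + C by rewrite addr_gt0.
    have [n [uw Sn]] := u_w (e / (2 + C)) (divr_gt0 e0 D0).
    have -> : S w = S (u n) - S (u n - w) by rewrite -linearB subKr.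
    apply: (le_lt_trans (vnormD _ _ _)); rewrite vnormN.
    have := SC (u n - w); move: uw Sn; rewrite !ltr_pdivlMr //; nra.
  have e2 : 0 < 2^-1 :> R by [].
  by have [n [uw _]] := u_w _ e2; have [_ _ /(_ w kw)] := uP n; lra.
move=> y adh.
have /choice [u uP] n : exists x,
    N (y - S x) < n.+1%:R^-1 /\ N x <= c * (N y + 1).
  have [|_ [x _ <-]] := adh n.+1%:R^-1; first by rewrite invr_gt0.
  rewrite -SE => xy.
  have [z kz xz] := cP x; exists (x - z); rewrite (linearB S) kz subr0; split=> //.
  apply: le_trans xz _; rewrite ler_pM2l //.
  have := vnorm_le_dist N (S x) y; rewrite vnormBC => Sx.
  have : n.+1%:R^-1 <= 1 :> R by rewrite invf_le1 // ler1n.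
  by move=> n1; have := lt_le_trans xy n1; lra.
have [|w wP] := cT u; first by exists (c * (N y + 1)) => n; case: (uP n).
exists (y + w) => //; apply/eqP; rewrite -subr_eq0; apply/eqP.
apply: (vnorm_small0 (N := N)) => e e0.
have D0 : 0 < 3 + 2 * C by rewrite addr_gt0 // mulr_gt0.
have e2 : 0 < e / (3 + 2 * C) by rewrite divr_gt0.
have [n0 n0P] := harmonic_small e2; have [n /n0P n_small Tw] := wP _ e2 n0.
have [Sn _] := uP n; have S_small := lt_trans Sn n_small.
have -> : y + w - T (y + w) - y = S ((y - S (u n)) - (T (u n) - w)) - (y - S (u n)).
  rewrite (_ : _ - (T (u n) - w) = y + w - u n); last first.
    by rewrite SE !opprB addrACA [_ - u n - _]addrAC subrr sub0r.
  by rewrite -SE (linearB S) opprB addrA subrK.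
apply: (le_lt_trans (vnormD _ _ _)); rewrite vnormN.
have := SC (y - S (u n) - (T (u n) - w)).
have := vnormD N (y - S (u n)) (- (T (u n) - w)); rewrite vnormN.
by move: Tw S_small; rewrite !ltr_pdivlMr //; nra.
Qed.

End Operators.

(** * The theorem of Riesz on the index *)

Section Index.
Context {R : realType} {s : scalars} {E : lmodType (scalar_field R s)}.
Context (N : vector_norm E) (T : {linear E -> E}) (cT : compact_op N T).

Lemma compact_op_comp (B : {linear E -> E}) : vbounded N B ->
  compact_op N (T \o B).
Proof.
move=> [C C0 BC] u [M uM]; apply: (cT (u := B \o u)).
by exists (C * M) => n; apply: le_trans (BC _) _; rewrite ler_pM2l.
Qed.

Local Notation S := (fun x => x - T x).

(** (1 - T)^n = 1 - T B with B the bounded operator given by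
    1 + (1 - T) + ... + (1 - T)^(n-1). *)
Lemma iter_compact_perturbation n : exists2 T' : {linear E -> E},
  compact_op N T' & forall x, iter n S x = x - T' x.
Proof.
suff [B Bbd BE] : exists2 B : {linear E -> E}, vbounded N B &
    forall x, iter n S x = x - T (B x).
  by exists (T \o B); [exact: compact_op_comp|].
elim: n => [|n [B Bbd BE]].
  exists \0; first by exists 1 => // x; rewrite vnorm0 mul1r vnorm_ge0.
  by move=> x; rewrite linear0 subr0.
have [C C0 TBC] := compact_op_bounded (compact_op_comp Bbd).
have [D D0 BD] := Bbd.
exists (B \+ (idfun \- (T \o B))).
  exists (D + (1 + C)); first lra.
  move=> x; apply: le_trans (vnormD _ _ _) _; rewrite mulrDl; apply: lerD => //.
  by apply: le_trans (vnormD _ _ _) _; rewrite vnormN mulrDl mul1r; apply: lerD => //.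
by move=> x; rewrite iterS BE /= (linearD T (B x)) opprD addrA.
Qed.

(** Let t be an exponent from which the kernels and ranges of the powers of S
    are constant, and K the kernel of S^t. Then ker S is contained in K, S maps
    K into itself, and K / S K is isomorphic to E / S E since E = K + S E and
    S x in K implies x in K. So both numbers are computed inside K, where they
    agree because dim S K = dim K - dim (ker S). *)
Theorem riesz_index0 : exists n,
  has_dim [set x | x - T x = 0] n /\ has_codim (range S) [set: E] n.
Proof.
pose Sl : {linear E -> E} := idfun \- T.
pose kerS n := [set x | iter n S x = 0]; pose imS n := range (iter n S).
have s_ker n : is_subspace (kerS n).
  have [T' _ T'E] := iter_compact_perturbation n.
  rewrite /kerS; under eq_set do rewrite T'E.
  exact: (subspace_ker (idfun \- T')).
have s_im n : is_subspace (imS n).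
  have [T' _ /funext T'E] := iter_compact_perturbation n.
  rewrite /imS T'E; exact: (subspace_image (idfun \- T') (@subspace_setT _ E)).
have ker_le n k : kerS n `<=` kerS (n + k)%N.
  move=> x; rewrite /kerS /mkset addnC iterD => ->; elim: k => //= k ->.
  by rewrite linear0 subr0.
have im_le n k : imS (n + k)%N `<=` imS n.
  by move=> _ [x _ <-]; exists (iter k S x); rewrite // iterD.
have [r rP] : exists r, kerS r.+1 `<=` kerS r.
  apply: contrapT => grows.
  apply: (@riesz_chain _ _ _ N T (fun n => kerS n.+1) kerS cT) => //.
  - move=> n; have [T' cT' T'E] := iter_compact_perturbation n.
    rewrite /kerS; under eq_set do rewrite T'E.
    apply: (vclosed_ker (f := idfun \- T')); have [C C0 T'C] := compact_op_bounded cT'.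
    exists (1 + C); [lra|move=> x].
    by apply: le_trans (vnormD _ _ _) _; rewrite vnormN mulrDl mul1r lerD2l.
  - by move=> n; rewrite -addn1; apply: ker_le.
  - move=> n; apply: contrapT => noX; apply: grows; exists n => x nx.
    by apply: contrapT => nx'; apply: noX; exists x.
  - by move=> n x; rewrite /kerS /mkset -iterSr.
  - by move=> i j ij; left; rewrite -(subnKC ij); apply: ker_le.
have [q qP] : exists q, imS q `<=` imS q.+1.
  apply: contrapT => shrinks.
  apply: (@riesz_chain _ _ _ N T imS (fun n => imS n.+1) cT) => //.
  - move=> n; have [T' cT' /funext T'E] := iter_compact_perturbation n.+1.
    rewrite /imS T'E; exact: vclosed_range cT'.
  - by move=> n; rewrite -addn1; apply: im_le.
  - move=> n; apply: contrapT => noX; apply: shrinks; exists n => x nx.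
    by apply: contrapT => nx'; apply: noX; exists x.
  - by move=> n _ [x _ <-]; exists x; rewrite // iterS.
  - by move=> i j ij; right; rewrite -(subnKC ij); apply: im_le.
have ker_stop k : kerS (r + k)%N `<=` kerS r.
  elim: k => [|k IH] x; first by rewrite addn0.
  by rewrite addnS /kerS /mkset iterSr => /IH; rewrite /kerS /mkset -iterSr => /rP.
have im_stop k : imS q `<=` imS (q + k)%N.
  elim: k => [|k IH]; first by rewrite addn0.
  move=> x /qP [y _ <-]; have [|z _ zy] := IH (iter q S y); first by exists y.
  by exists z => //; rewrite addnS !iterS zy.
(* The successor makes ker S a subspace of the kernel of S^t. *)
pose t := (r + q).+1.
have ker_t k : kerS (t + k)%N `<=` kerS t.
  rewrite /t -addnS -addnA; apply: subset_trans (@ker_stop _) (@ker_le _ _).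
have im_t k : imS t `<=` imS (t + k)%N.
  rewrite /t -addSn addnC -addnA.
  exact: subset_trans (@im_le _ _) (@im_stop _).
have [T' cT' T'E] := iter_compact_perturbation t.
have iterB u v : iter t S (u - v) = iter t S u - iter t S v.
  by rewrite !T'E; exact: (linearB (idfun \- T')).
have s0 := @subspace_set0 _ E.
have sub0 X : is_subspace X -> [set 0 : E] `<=` X.
  by move=> sX _ ->; apply: subspace0.
have [p Kp] : exists p, has_dim (kerS t) p.
  have [p] := ker_has_dim cT'; exists p; rewrite /kerS.
  by under eq_set do rewrite T'E.
have ker1 : kerS 1 `<=` kerS t by rewrite /t -add1n; apply: ker_le.
have [n [b [pE dim_ker K_b]]] :=
  has_codim_split s0 (s_ker 1%N) (s_ker t) (sub0 _ (s_ker _)) ker1 Kp.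
exists n; split=> //.
pose SK := S @` kerS t.
have sSK : is_subspace SK := subspace_image Sl (s_ker t).
have SK_b : has_dim SK b.
  apply: (proj1 (has_codim_transfer (f := Sl) _
    (s_ker 1%N) (s_ker t) s0 sSK _ _ _)) K_b => //.
  - by move=> x Kx; exists x.
  - by move=> _ [x Kx <-]; exists x => //=; rewrite subrr.
have SKK : SK `<=` kerS t.
  move=> _ [x Kx <-]; rewrite /kerS /mkset -iterSr iterS Kx linear0 subr0 //.
have [b' [n' [pE' SK_b' K_n']]] :=
  has_codim_split s0 sSK (s_ker t) (sub0 _ sSK) SKK Kp.
have bb' := has_codim_uniq s0 sSK SK_b SK_b'.
have <- : n' = n by apply/eqP; rewrite -(eqn_add2l b) {1}bb' -pE' pE addnC.
apply: (proj1 (has_codim_transfer (f := idfun) _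
  sSK (s_ker t) (s_im 1%N) (@subspace_setT _ E) _ _ _)) K_n' => //=.
- move=> x Kx; split=> [[y _ yx]|[y Ky yx]]; last by exists y.
  exists y => //; apply: (ker_t 1%N).
  by rewrite /kerS /mkset addn1 iterSr; rewrite /= in yx; rewrite yx.
- move=> x _; have [|y _ yx] := im_t t (iter t S x); first by exists x.
  exists (x - iter t S y).
    by rewrite /kerS /mkset iterB -iterD yx subrr.
  rewrite subKr; have [|z _ <-] := im_t 1%N (iter t S y); first by exists y.
  by exists (iter t S z); rewrite // addn1 iterS.
Qed.

End Index.

(** * Graphs of closed mappings *)

Lemma exists_linear (K : fieldType) (U V : lmodType K) (f : U -> V) :
  linear f -> exists g : {linear U -> V}, forall x, g x = f x.
Proof.
move=> lin_f.
by exists (HB.pack_for {linear U -> V} f (GRing.isLinear.Build _ _ _ _ f lin_f)).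
Qed.

Section DomainSpace.
Context {K : numFieldType} {H1 H2 : normedModType K}.
Context (A : closed_mapping H1 H2).

Definition dom_pred : {pred H1} := [in cdom A].

HB.instance Definition _ :=
  GRing.isSubmodClosed.Build K H1 dom_pred
    (GRing.submod_closed_semi (cdom_subspace A)).

(** The domain of A as a vector space of its own: on it A is a total linear map,
    and it can carry the graph norm. *)
Record dom_space := DomSpace { dom_val :> H1; _ : dom_val \in dom_pred }.

HB.instance Definition _ := [isSub for dom_val].
HB.instance Definition _ := [Choice of dom_space by <:].
HB.instance Definition _ := [SubChoice_isSubLmodule of dom_space by <:].

Lemma dom_valP (x : dom_space) : cdom A (dom_val x).
Proof. by case: x => x /=; rewrite inE. Qed.

Lemma dom_val_onto h (Ah : cdom A h) : exists x : dom_space, dom_val x = h.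
Proof.
have Ah' : h \in dom_pred by rewrite inE.
by exists (DomSpace Ah').
Qed.

Lemma cfunB u v : cdom A u -> cdom A v -> A (u - v) = A u - A v.
Proof. by move=> Au Av; rewrite addrC -scaleN1r cfun_linear // scaleN1r addrC. Qed.

Lemma cfun0 : A 0 = 0.
Proof.
have A0 := subspace0 (cdom_subspace A).
by have := cfunB A0 A0; rewrite !subrr.
Qed.

Lemma cfunN u : cdom A u -> A (- u) = - A u.
Proof.
move=> Au; have A0 := subspace0 (cdom_subspace A).
by rewrite -sub0r cfunB // cfun0 sub0r.
Qed.

Lemma cfunZ a u : cdom A u -> A (a *: u) = a *: A u.
Proof.
move=> Au; have A0 := subspace0 (cdom_subspace A).
by rewrite -[a *: u]addr0 cfun_linear // cfun0 addr0.
Qed.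

Lemma cfunD u v : cdom A u -> cdom A v -> A (u + v) = A u + A v.
Proof. by move=> Au Av; rewrite -[u]scale1r cfun_linear // !scale1r. Qed.

Lemma subspace_graph1 : is_subspace (graph1 A).
Proof.
have A0 := subspace0 (cdom_subspace A).
apply/is_subspaceP; split; first by split; rewrite //= cfun0.
move=> a u v [Au uA] [Av vA]; split; first exact: subspaceZD (cdom_subspace A) Au Av.
by rewrite /= cfun_linear // uA vA.
Qed.

Lemma subspace_graph2 (B : {linear H2 -> H1}) : is_subspace (graph2 B).
Proof.
apply/is_subspaceP; split; first by rewrite /graph2 /= linear0.
by move=> a u v; rewrite /graph2 /= => -> ->; rewrite linearP.
Qed.

Lemma subspace_dom_prod : is_subspace (cdom A `*` [set: H2]).
Proof.
apply/is_subspaceP; split; first by split => //; exact: subspace0 (cdom_subspace A).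
by move=> a u v [Au _] [Av _]; split => //; exact: subspaceZD (cdom_subspace A) Au Av.
Qed.

End DomainSpace.

Section GraphExcess.
Context {K : numFieldType} {H1 H2 : normedModType K}.
Context (A1 : closed_mapping H1 H2) (A2 : {linear H2 -> H1}).
Context (A1A2 : forall h, cdom A1 (A2 h)).

Let sdom := cdom_subspace A1.
Let sG1 := subspace_graph1 A1.
Let sG2 := subspace_graph2 A2.
Let sS := subspace_dom_prod A1.
Let sG12 := subspaceI sG1 sG2.
Let sG1D2 := subspace_sum sG1 sG2.
Let s0 := @subspace_set0 K (H1 * H2)%type.

Lemma graph1_sub : graph1 A1 `<=` cdom A1 `*` [set: H2].
Proof. by move=> p []. Qed.

Lemma graph2_sub : graph2 A2 `<=` cdom A1 `*` [set: H2].
Proof. by move=> p; rewrite /graph2 /= => pE; split; rewrite //= pE. Qed.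

(** The kernel is sent to the intersection of the graphs by h |-> (A2 h, h), and
    the cokernel to the quotient by their sum by h |-> (0, h). *)
Lemma graph_excess_cod (T : {linear H2 -> H2}) n : (forall h, T h = A1 (A2 h)) ->
  has_dim [set h | h - T h = 0] n ->
  has_codim (range (fun h => h - T h)) [set: H2] n ->
  quasi_complementary_excess (cdom A1 `*` [set: H2]) (graph1 A1) (graph2 A2) 0.
Proof.
move=> TE ker_n coker_n.
split; [exact: graph1_sub|exact: graph2_sub|exists n, n; split; last by rewrite subrr].
- have [f fE] : exists f : {linear H2 -> (H1 * H2)%type}, forall h, f h = (A2 h, h).
    by apply: exists_linear => a u v; rewrite linearP.
  apply: (proj1 (has_codim_transfer (f := f) _
    subspace_set0 _ s0 sG12 _ _ _)) ker_n => //.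
  + exact: (subspace_ker (idfun \- T)).
  + by move=> h /= /subr0_eq hT; rewrite fE; split=> //; split=> //=; rewrite -TE.
  + by move=> h _; rewrite fE /=; split=> [[_ ->]|->] //; rewrite linear0.
  + move=> [a b] [[/= Aa bE] aE]; rewrite /graph2 /= in aE.
    by exists b; rewrite /= ?fE ?TE -?aE -?bE subrr.
- have [g gE] : exists g : {linear H2 -> (H1 * H2)%type}, forall h, g h = (0, h).
    apply: exists_linear => a u v; congr pair; by rewrite /= scaler0 addr0.
  apply: (proj1 (has_codim_transfer (f := g) _
    _ subspace_setT sG1D2 sS _ _ _)) coker_n => //.
  + exact: (subspace_image (idfun \- T) (@subspace_setT _ H2)).
  + by move=> h _; rewrite gE; split=> //; exact: subspace0.
  + move=> h _; rewrite gE; split.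
      move=> [[x y] [/= Ax yE] [[z k] zE]]; rewrite /graph2 /= in zE => -[xz yk].
      exists k => //; rewrite TE -zE -yk yE.
      by rewrite -(addr0_eq xz) cfunN // opprK addrC.
    move=> [k _ <-]; exists (- A2 k, - T k).
      by split; [exact: subspaceN|rewrite /= TE cfunN].
    by exists (A2 k, k) => //; congr pair; rewrite /= ?addNr // addrC.
  + move=> [x y] [/= Ax _]; exists (y - A1 x) => //; rewrite gE.
    apply: sub_suml => //; split; rewrite /= ?subr0 //=; exact: subKr.
Qed.

(** Here the maps are x |-> (x, A1 x) and x |-> (x, 0). *)
Lemma graph_excess_dom (T : {linear dom_space A1 -> dom_space A1}) n :
  (forall x, dom_val (T x) = A2 (A1 (dom_val x))) ->
  has_dim [set x | x - T x = 0] n ->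
  has_codim (range (fun x => x - T x)) [set: dom_space A1] n ->
  quasi_complementary_excess (cdom A1 `*` [set: H2]) (graph1 A1) (graph2 A2) 0.
Proof.
move=> TE ker_n coker_n.
split; [exact: graph1_sub|exact: graph2_sub|exists n, n; split; last by rewrite subrr].
- have [f fE] : exists f : {linear dom_space A1 -> (H1 * H2)%type},
      forall x, f x = (dom_val x, A1 (dom_val x)).
    apply: exists_linear => a u v; congr pair.
    by rewrite /= -cfun_linear //; exact: dom_valP.
  apply: (proj1 (has_codim_transfer (f := f) _
    subspace_set0 _ s0 sG12 _ _ _)) ker_n => //.
  + exact: (subspace_ker (idfun \- T)).
  + move=> x /= /subr0_eq xT; rewrite fE; split; first by split=> //; exact: dom_valP.
    by rewrite /graph2 /= -TE -xT.
  + move=> x _; rewrite fE /=; split=> [[x0 _]|->]; first exact: val_inj.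
    by rewrite /= cfun0.
  + move=> [a b] [[/= Aa bE] aE]; rewrite /graph2 /= in aE.
    have [x xa] := dom_val_onto Aa; exists x; last by rewrite fE xa -bE subrr.
    by apply: val_inj; rewrite /= TE xa -bE -aE subrr.
- have [g gE] : exists g : {linear dom_space A1 -> (H1 * H2)%type},
      forall x, g x = (dom_val x, 0).
    apply: exists_linear => a u v; congr pair; by rewrite /= scaler0 addr0.
  apply: (proj1 (has_codim_transfer (f := g) _
    _ subspace_setT sG1D2 sS _ _ _)) coker_n => //.
  + exact: (subspace_image (idfun \- T) (@subspace_setT _ _)).
  + by move=> x _; rewrite gE; split=> //; exact: dom_valP.
  + move=> x _; rewrite gE; split.
      move=> [[h y] [/= Ah yE] [[z k] zE]]; rewrite /graph2 /= in zE => -[hz yk].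
      have [u uh] := dom_val_onto Ah; exists u => //; apply: val_inj.
      rewrite /= TE uh -hz zE; congr (_ + _).
      by rewrite -(addr0_eq yk) linearN yE.
    move=> [u _ <-]; exists (dom_val u, A1 (dom_val u)).
      by split=> //; exact: dom_valP.
    exists (- A2 (A1 (dom_val u)), - A1 (dom_val u)).
      by rewrite /graph2 /= linearN.
    by congr pair; rewrite /= ?subrr // TE.
  + move=> [x y] [/= Ax _]; have [u uE] := dom_val_onto (subspaceB sdom Ax (A1A2 y)).
    exists u => //; rewrite gE uE.
    by apply: sub_sumr => //; rewrite /graph2 /= subKr subr0.
Qed.

End GraphExcess.

(** * Compactness of the composites *)

Section CompactMappings.
Context {R : realType} {s : scalars}.
Local Notation K := (scalar_field R s).

Lemma modulusK (a : K) : 0 <= a -> of_real (modulus a) = a.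
Proof. by move=> a0; rewrite of_real_modulus ger0_norm. Qed.

Lemma compact_on_cluster (E : lmodType K) (D : set E) (F : E -> K) (T : E -> E) :
  compact_on D F T -> forall u : nat -> E, (forall n, D (u n)) ->
  (exists M : K, forall n, F (u n) <= M) ->
  exists2 w, D w & forall e : R, 0 < e -> forall n0, exists2 n, (n0 <= n)%N &
    modulus (F (T (u n) - w)) < e.
Proof.
move=> cT u Du bu; have [phi [phi_incr [w Dw cvg_w]]] := cT u Du bu.
exists w => // e e0 n0.
have e0' : 0 < of_real e :> K by rewrite -of_real0 of_real_lt.
have [n1 _ n1P] := (cvgr0_norm_lt _ cvg_w) _ e0'.
have phi_ge n : (n <= phi n)%N.
  elim: n => // n IH; apply: leq_ltn_trans IH _.
  by move/increasing_seqP: phi_incr; apply.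
exists (phi (maxn n0 n1)); first exact: leq_trans (leq_maxl _ _) (phi_ge _).
by rewrite -(of_real_lt (s := s)) of_real_modulus; apply/n1P/leq_maxr.
Qed.

Section RealNorm.
Context {V : normedModType K}.

Definition real_norm (v : V) : R := modulus `|v|.

Lemma of_real_norm v : of_real (real_norm v) = `|v|.
Proof. exact: modulusK. Qed.

Lemma real_normZ a v : real_norm (a *: v) = modulus a * real_norm v.
Proof.
by apply: (of_real_inj (s := s)); rewrite of_realM !of_real_norm of_real_modulus normrZ.
Qed.

Lemma real_normD u v : real_norm (u + v) <= real_norm u + real_norm v.
Proof. by rewrite -(of_real_le (s := s)) of_realD !of_real_norm ler_normD. Qed.

Lemma real_norm_eq0 v : real_norm v = 0 -> v = 0.
Proof. by move=> v0; apply/normr0_eq0; rewrite -of_real_norm v0 of_real0. Qed.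

Definition ambient_norm : vector_norm V :=
  VectorNorm real_normZ real_normD real_norm_eq0.

Lemma compact_on_setT (T : V -> V) :
  compact_on [set: V] (fun v => `|v|) T -> compact_op ambient_norm T.
Proof.
move=> cT u [M uM].
have [||w _ wP] := compact_on_cluster cT (u := u); first by [].
  by exists (of_real M) => n; rewrite -of_real_norm of_real_le; apply: uM.
by exists w => e e0 n0; have [n n0n] := wP e e0 n0; exists n.
Qed.

End RealNorm.

Section GraphNorm.
Context {H1 H2 : normedModType K} (A : closed_mapping H1 H2).

(** The sum is equivalent to the square root of [graph_norm_sqr], and easier to
    handle as a norm. *)
Definition graph_sum_norm (x : dom_space A) : R :=
  real_norm (dom_val x) + real_norm (A (dom_val x)).

Fact graph_normZ a x : graph_sum_norm (a *: x) = modulus a * graph_sum_norm x.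
Proof.
rewrite /graph_sum_norm /= cfunZ; last exact: dom_valP.
by rewrite !real_normZ mulrDr.
Qed.

Fact graph_normD x y : graph_sum_norm (x + y) <= graph_sum_norm x + graph_sum_norm y.
Proof.
rewrite /graph_sum_norm /= cfunD; [|exact: dom_valP|exact: dom_valP].
by rewrite addrACA; apply: lerD; apply: real_normD.
Qed.

Fact graph_norm_eq0 x : graph_sum_norm x = 0 -> x = 0.
Proof.
have := modulus_ge0 `|dom_val x|; have := modulus_ge0 `|A (dom_val x)|.
rewrite /graph_sum_norm /real_norm => Ax0 x0 sum0.
by apply/val_inj/real_norm_eq0; rewrite /real_norm; lra.
Qed.

Definition graph_norm : vector_norm (dom_space A) :=
  VectorNorm graph_normZ graph_normD graph_norm_eq0.

Lemma graph_norm_sqrE v : graph_norm_sqr A v =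
  of_real (real_norm v ^+ 2 + real_norm (A v) ^+ 2).
Proof. by rewrite of_realD !of_realM !of_real_norm. Qed.

Lemma compact_on_dom (B : {linear H2 -> H1}) (T : dom_space A -> dom_space A) :
  (forall x, dom_val (T x) = B (A (dom_val x))) ->
  compact_on (cdom A) (graph_norm_sqr A) (B \o A) ->
  compact_op graph_norm T.
Proof.
move=> TE cBA u [M uM].
have [||w Aw wP] := compact_on_cluster cBA (u := fun n => dom_val (u n)).
- by move=> n; apply: dom_valP.
- exists (of_real (M ^+ 2)) => n; rewrite graph_norm_sqrE of_real_le.
  have := modulus_ge0 `|dom_val (u n)|; have := modulus_ge0 `|A (dom_val (u n))|.
  have := uM n; rewrite /= /graph_sum_norm /real_norm; nra.
have [x xw] := dom_val_onto Aw; exists x => e e0 n0.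
have e2 : 0 < (e / 2) ^+ 2 by rewrite exprn_gt0 // divr_gt0.
have [n n0n Fn] := wP _ e2 n0; exists n => //; move: Fn.
rewrite graph_norm_sqrE modulus_of_real ger0_norm; last by rewrite addr_ge0 ?sqr_ge0.
rewrite /= /graph_sum_norm /= TE xw.
have := modulus_ge0 `|B (A (dom_val (u n))) - w|.
have := modulus_ge0 `|A (B (A (dom_val (u n))) - w)|.
rewrite /real_norm; set p := modulus _; set q := modulus _ => p0 q0 pq.
have p_small : q < e / 2 by rewrite -(ltr_pXn2r (n := 2)) ?nnegrE //; nra.
have q_small : p < e / 2 by rewrite -(ltr_pXn2r (n := 2)) ?nnegrE //; nra.
lra.
Qed.

End GraphNorm.
End CompactMappings.

Theorem theorem4p10 (R : realType) (s : scalars) (H1 H2 : hilbertType R s)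
    (V1 V2 : set (H1 * H2)%type)
    (A1 : closed_mapping H1 H2) (A2 : {linear H2 -> H1}) (d1 d2 : int)
    (V1_subspace : is_subspace V1) (V2_subspace : is_subspace V2)
    (V1_dom : V1 `<=` cdom A1 `*` [set: H2])
    (V2_dom : V2 `<=` cdom A1 `*` [set: H2])
    (A2_bounded : bounded_near A2 (nbhs (0 : H2)))
    (V1_reldim : comparable_reldim V1 (graph1 A1) d1)
    (V2_reldim : comparable_reldim V2 (graph2 A2) d2)
    (A1A2_defined : forall h : H2, cdom A1 (A2 h))
    (compactness :
      compact_on [set: H2] (fun h : H2 => `|h|) (A1 \o A2) \/
      compact_on (cdom A1) (graph_norm_sqr A1) (A2 \o A1)) :
  quasi_complementary_excess (cdom A1 `*` [set: H2]) V1 V2 (d1 + d2).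
Proof.
have excess0 : quasi_complementary_excess (cdom A1 `*` [set: H2])
    (graph1 A1) (graph2 A2) 0.
  case: compactness => [cA1A2|cA2A1].
  - have [T TE] : exists T : {linear H2 -> H2}, forall h, T h = A1 (A2 h).
      by apply: exists_linear => a u v; rewrite linearP cfun_linear.
    have cT : compact_op (@ambient_norm R s H2) T.
      apply: compact_on_setT.
      by rewrite (_ : T = A1 \o A2 :> (_ -> _)) //; apply/funext.
    have [n [ker_n coker_n]] := riesz_index0 cT.
    exact: graph_excess_cod TE ker_n coker_n.
  - have /choice [T0 T0E] (x : dom_space A1) : exists y : dom_space A1,
        dom_val y = A2 (A1 (dom_val x)) by exact: dom_val_onto.
    have [T TE] : exists T : {linear dom_space A1 -> dom_space A1},
        forall x, T x = T0 x.
      apply: exists_linear => a u v; apply: val_inj.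
      by rewrite /= !T0E /= cfun_linear ?linearP //; exact: dom_valP.
    have {}TE x : dom_val (T x) = A2 (A1 (dom_val x)) by rewrite TE T0E.
    have [n [ker_n coker_n]] := riesz_index0 (compact_on_dom TE cA2A1).
    exact: graph_excess_dom TE ker_n coker_n.
have sS := subspace_dom_prod A1.
have sG1 := subspace_graph1 A1; have sG2 := subspace_graph2 A2.
rewrite -[d1]add0r.
apply: excessC; apply: excess_comparable V2_reldim _ => //.
apply: excessC; exact: excess_comparable V1_reldim excess0.
Qed.
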